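(* For $x>0$ and $t\in\mathbb R$ let $K(x,t)$ be the generalized Kantorovich constant \[K(x,t)=\frac{x^t-x}{(t-1)(x-1)}\left(\frac{t-1}{t}\,\frac{x^t-1}{x^t-x}\right)^t.\] It satisfies the following monotonicity properties in $x$. (i) If $t<0$ or $t>1$, then $x\mapsto K(x,t)$ is monotone decreasing when $0<x<1$ and monotone increasing when $x>1$, and $K(x,t)$ takes the minimum value $1$ when $x=1$. (ii) If $0<t<1$, then $x\mapsto K(x,t)$ is monotone increasing when $0<x<1$ and monotone decreasing when $x>1$, and $K(x,t)$ takes the maximum value $1$ when $x=1$.
   Context: At $x=1$ the constant is defined by its limit, $K(1,t)=\lim_{x\to1}K(x,t)=1$. *)

(* Defs.v *)
From HB Require Import structures.
From mathcomp Require Import all_boot all_order all_algebra.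
From mathcomp Require Import all_classical all_reals all_analysis.
Import Order.TTheory GRing.Theory Num.Theory.
Import numFieldNormedType.Exports.

Set Implicit Arguments.
Unset Strict Implicit.
Unset Printing Implicit Defensive.

Local Open Scope classical_set_scope.
Local Open Scope ring_scope.

(* Meaningful for x > 0, x != 1 and t different from 0 and 1; the base of the
   outer power is then positive, so powR is the usual real power throughout.
   Elsewhere the value is an artefact of total division. *)
Definition kantorovich_formula (R : realType) (x t : R) : R :=
  (x `^ t - x) / ((t - 1) * (x - 1)) *
  ((t - 1) / t * ((x `^ t - 1) / (x `^ t - x))) `^ t.

(* The limit is over the punctured neighborhoods of 1, so the junk value of
   the formula at x = 1 plays no role. *)
Definition kantorovich (R : realType) (x t : R) : R :=
  if x == 1 then lim (kantorovich_formula y t @[y --> (1 : R)^'])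
  else kantorovich_formula x t.

(* Main.v *)
(** Fix [x], and let [L_x z = 1 + (x^t - 1) / (x - 1) * (z - 1)] be the chord
    of the power function [z^t] through [1] and [x].  Bernoulli's inequality
    shows that, for [t < 0] or [1 < t], [K(x, t)] is the maximum over [z > 0]
    of [L_x z / z^t], attained at a point [z_x] lying on the same side of [1]
    as [x]; for [0 < t < 1] it is the minimum.  By convexity (concavity) the
    slope of [L_x] is monotone in [x], hence [L_x z] is monotone in [x] for
    each [z] on a given side of [1], and so is the extremum.  Taking [z = 1]
    compares [K] with [1].  Both ranges of [t] are treated at once by
    multiplying the inequalities by [t * (t - 1)]. *)

Require Import Defs.
From HB Require Import structures.
From mathcomp Require Import all_boot all_order all_algebra.
From mathcomp Require Import all_classical all_reals all_analysis.
From mathcomp Require Import ring lra.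
Import Order.TTheory GRing.Theory Num.Theory.
Import numFieldNormedType.Exports.

Local Open Scope classical_set_scope.
Local Open Scope ring_scope.

(** * Mean value and Bernoulli inequalities for real powers *)

Lemma powR_MVT (R : realType) (t a b : R) : 0 < a -> a < b ->
  exists2 c, a < c < b & b `^ t - a `^ t = t * c `^ (t - 1) * (b - a).
Proof.
move=> a0 ab.
have der (x : R) : 0 < x -> is_derive x 1 (fun y : R => y `^ t) (t * x `^ (t - 1)).
  by move=> x0; exact: is_derive1_powR.
have [||c] := @MVT R (fun y => y `^ t) (fun y => t * y `^ (t - 1)) _ _ ab.
- by move=> x; rewrite in_itv/= => /andP[ax _]; apply: der; exact: lt_trans ax.
- apply: derivable_within_continuous => x; rewrite in_itv/= => /andP[ax _].
  by have [] := der x (lt_le_trans a0 ax).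
by rewrite in_itv/=; exists c.
Qed.

(** The product inequality records that [c] lies on the same side of [1] as [x], so that later sign
    arguments need no case split. *)
Lemma powR_sub1_MVT (R : realType) (t x : R) : 0 < x ->
  exists c, [/\ 0 < c, 0 <= (c - 1) * (x - 1) &
    x `^ t - 1 = t * c `^ (t - 1) * (x - 1)].
Proof.
move=> x0; have [x1|x1|->] := ltgtP x 1.
- have [c /andP[xc c1]] := @powR_MVT R t _ _ x0 x1.
  rewrite powR1 => E; exists c; split; [exact: lt_trans xc|nra|lra].
- have [c /andP[c1 cx]] := @powR_MVT R t _ _ ltr01 x1.
  by rewrite powR1 => E; exists c; split => //; [lra|nra].
- by exists 1; rewrite powR1 !subrr !mulr0.
Qed.

Lemma powR_sub1_sign (R : realType) (s x : R) : 0 < x ->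
  0 <= s * (x - 1) * (x `^ s - 1).
Proof.
move=> x0; have [c [c0 _ ->]] := @powR_sub1_MVT R s _ x0.
have -> : s * (x - 1) * (s * c `^ (s - 1) * (x - 1)) =
          c `^ (s - 1) * (s * (x - 1)) ^+ 2 by ring.
by rewrite mulr_ge0 ?powR_ge0 ?sqr_ge0.
Qed.

(** The mean value theorem turns the gap into [t * (c ^ (t - 1) - 1) * (w - 1)], and
    [c ^ (t - 1) - 1] has the sign of [(t - 1) * (c - 1)], with [c] on the side of [w]. *)
Lemma powR_bernoulli (R : realType) (t w : R) : 0 < w ->
  0 <= t * (t - 1) * (w `^ t - 1 - t * (w - 1)).
Proof.
move=> w0; have [c [c0 cw ->]] := @powR_sub1_MVT R t _ w0.
have := @powR_sub1_sign R (t - 1) _ c0; set p := c `^ _ => hp.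
have -> : t * (t - 1) * (t * p * (w - 1) - t * (w - 1)) =
          t ^+ 2 * ((t - 1) * (p - 1) * (w - 1)) by ring.
rewrite mulr_ge0 ?sqr_ge0//.
have [c1|c1] := eqVneq c 1; first by rewrite /p c1 powR1 subrr mulr0 mul0r.
(* The product of [hp] and [cw] is the goal times [(c - 1) ^ 2], which can be cancelled. *)
have c2 : 0 < (c - 1) ^+ 2 by rewrite exprn_even_gt0 ?subr_eq0.
by rewrite -(pmulr_rge0 _ c2); have := mulr_ge0 hp cw; congr (0 <= _); ring.
Qed.

(** Bernoulli at [y / x], scaled by [x ^ t]; the quotient [x ^ t / x] is the power [x ^ (t - 1)] in
    the tangent slope. *)
Lemma powR_tangent (R : realType) (t x y : R) : 0 < x -> 0 < y ->
  0 <= t * (t - 1) * (y `^ t - x `^ t - t * (x `^ t / x) * (y - x)).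
Proof.
move=> x0 y0; have w0 : 0 < y / x by rewrite divr_gt0.
have yE : y `^ t = x `^ t * (y / x) `^ t.
  by rewrite -powRM ?(ltW x0) ?(ltW w0)// mulrCA divff ?mulr1 ?gt_eqF.
have -> : t * (t - 1) * (y `^ t - x `^ t - t * (x `^ t / x) * (y - x)) =
    x `^ t * (t * (t - 1) * ((y / x) `^ t - 1 - t * (y / x - 1))).
  by rewrite yE; field; rewrite gt_eqF.
by rewrite mulr_ge0 ?powR_ge0 ?powR_bernoulli.
Qed.

(** * Slopes of chords of the power function through [1] *)

Definition powR_chord (R : realType) (x t : R) : R := (x `^ t - 1) / (x - 1).

Lemma powR_chord_mono (R : realType) (t x y : R) : 0 < x -> x <= y ->
  0 < (x - 1) * (y - 1) ->
  0 <= t * (t - 1) * (powR_chord R y t - powR_chord R x t).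
Proof.
move=> x0 xy xy1; have y0 := lt_le_trans x0 xy.
have nx : x - 1 != 0 by apply: contraTneq xy1 => ->; rewrite mul0r ltxx.
have ny : y - 1 != 0 by apply: contraTneq xy1 => ->; rewrite mulr0 ltxx.
rewrite -(pmulr_lge0 _ xy1).
have -> : t * (t - 1) * (powR_chord R y t - powR_chord R x t) *
    ((x - 1) * (y - 1)) =
    t * (t - 1) * ((y `^ t - 1) * (x - 1) - (x `^ t - 1) * (y - 1)).
  by rewrite /powR_chord; field; rewrite nx ny.
have [x1|x1|x1] := ltgtP x 1; last by rewrite x1 subrr eqxx in nx.
(* The tangent is taken at the middle one of the points [x], [y], [1], here [y] and below [x]; the
   weights are chosen so that its slope [D] cancels. *)
- have := @powR_tangent R t _ _ y0 x0; have := @powR_tangent R t _ _ y0 ltr01.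
  rewrite powR1; set D := t * (_ / y); set k := t * (t - 1) => h1 h2.
  have -> : k * ((y `^ t - 1) * (x - 1) - (x `^ t - 1) * (y - 1)) =
    k * (1 - y `^ t - D * (1 - y)) * (y - x) +
    k * (x `^ t - y `^ t - D * (x - y)) * (1 - y) by ring.
  by rewrite addr_ge0 // mulr_ge0 //; nra.
- have := @powR_tangent R t _ _ x0 y0; have := @powR_tangent R t _ _ x0 ltr01.
  rewrite powR1; set D := t * (_ / x); set k := t * (t - 1) => h1 h2.
  have -> : k * ((y `^ t - 1) * (x - 1) - (x `^ t - 1) * (y - 1)) =
    k * (y `^ t - x `^ t - D * (y - x)) * (x - 1) +
    k * (1 - x `^ t - D * (1 - x)) * (y - x) by ring.
  by rewrite addr_ge0 // mulr_ge0 //; nra.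
Qed.

Lemma powR_chord_gt0 (R : realType) (t x : R) : t != 0 -> 0 < x -> x != 1 ->
  0 < powR_chord R x t / t.
Proof.
move=> t0 x0 x1; rewrite /powR_chord.
have [c [c0 _ ->]] := @powR_sub1_MVT R t _ x0.
have -> : t * c `^ (t - 1) * (x - 1) / (x - 1) / t = c `^ (t - 1).
  by field; rewrite t0 subr_eq0 x1.
exact: powR_gt0.
Qed.

(** Since [x ^ t - x = x * (x ^ (t - 1) - 1)], this is a chord slope for the exponent [t - 1]. *)
Lemma powR_subx_gt0 (R : realType) (t x : R) : t != 1 -> 0 < x -> x != 1 ->
  0 < (x `^ t - x) / ((t - 1) * (x - 1)).
Proof.
move=> t1 x0 x1.
have -> : (x `^ t - x) / ((t - 1) * (x - 1)) =
    x * (powR_chord R x (t - 1) / (t - 1)).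
  have xN0 : (t == 1) ==> (x != 0) by rewrite (gt_eqF x0) implybT.
  rewrite /powR_chord (@powRB R _ _ _ xN0) powRr1 ?ltW//.
  by field; rewrite !subr_eq0 t1 x1 gt_eqF.
by rewrite mulr_gt0 ?powR_chord_gt0 ?subr_eq0.
Qed.

(** * The constant as an extremum over [z] *)

(** Let [A] be the first factor of the formula and [B] the chord slope over [t]. The base of the
    power is [B / A], so this is Bernoulli at [B / A * z] multiplied by [A]; the constant terms
    agree because [(1 - t) * A = 1 - t * B]. *)
Lemma kantorovich_formula_chord (R : realType) (t x z : R) :
  t != 0 -> t != 1 -> 0 < x -> x != 1 -> 0 < z ->
  0 <= t * (t - 1) *
    (kantorovich_formula x t * z `^ t - (1 + powR_chord R x t * (z - 1))).
Proof.
move=> t0 t1 x0 x1 z0.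
have B0 := @powR_chord_gt0 R _ _ t0 x0 x1.
have A0 := @powR_subx_gt0 R _ _ t1 x0 x1.
have nx : x `^ t - x != 0 by apply: contraTneq A0 => ->; rewrite mul0r ltxx.
have baseE : (t - 1) / t * ((x `^ t - 1) / (x `^ t - x)) =
    (powR_chord R x t / t) / ((x `^ t - x) / ((t - 1) * (x - 1))).
  by rewrite /powR_chord; field; rewrite t0 nx !subr_eq0 x1 t1.
have w0 := mulr_gt0 (divr_gt0 B0 A0) z0.
have := @powR_bernoulli R t _ w0.
rewrite powRM ?(ltW z0) ?(ltW (divr_gt0 B0 A0))// -baseE.
rewrite -(pmulr_rge0 _ A0) => /le_trans; apply; rewrite le_eqVlt; apply/orP.
left; apply/eqP; rewrite /kantorovich_formula baseE /powR_chord.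
by field; rewrite t0 nx !subr_eq0 x1 t1.
Qed.

Lemma kantorovich_formula_attained (R : realType) (t x : R) :
  t != 0 -> t != 1 -> 0 < x -> x != 1 ->
  exists z, [/\ 0 < z, 0 <= (x - 1) * (z - 1) &
    kantorovich_formula x t * z `^ t = 1 + powR_chord R x t * (z - 1)].
Proof.
move=> t0 t1 x0 x1.
have B0 := @powR_chord_gt0 R _ _ t0 x0 x1.
have A0 := @powR_subx_gt0 R _ _ t1 x0 x1.
have nx : x `^ t - x != 0 by apply: contraTneq A0 => ->; rewrite mul0r ltxx.
have n1 : x `^ t - 1 != 0.
  by apply: contraTneq B0; rewrite /powR_chord => ->; rewrite !mul0r ltxx.
(* The choice [z = A / B] makes the argument of Bernoulli equal to [1], its equality case. *)
have z0 := divr_gt0 A0 B0; set z := _ / _ in z0.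
exists z; split => //.
(* The side of [z] comes from Bernoulli once more, now at [x] itself. *)
- have -> : (x - 1) * (z - 1) =
      t * (t - 1) * (x `^ t - 1 - t * (x - 1)) /
      (powR_chord R x t / t * (t * (t - 1)) ^+ 2).
    by rewrite /z /powR_chord; field; rewrite t0 n1 !subr_eq0 x1 t1.
  by rewrite divr_ge0 ?powR_bernoulli// mulr_ge0 ?sqr_ge0 ?ltW.
- have -> : kantorovich_formula x t * z `^ t =
      (x `^ t - x) / ((t - 1) * (x - 1)).
    rewrite /kantorovich_formula.
    have -> : (t - 1) / t * ((x `^ t - 1) / (x `^ t - x)) = z^-1.
      by rewrite /z /powR_chord; field; rewrite t0 nx n1 !subr_eq0 x1 t1.
    rewrite -mulrA -powRM ?invr_ge0 ?(ltW z0)// mulVf ?gt_eqF// powR1.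
    by rewrite mulr1.
  by rewrite /z /powR_chord; field; rewrite t0 n1 !subr_eq0 x1 t1.
Qed.

Lemma kantorovich_formula_mono (R : realType) (t x y : R) :
  t != 0 -> t != 1 -> 0 < x -> x <= y -> 0 < (x - 1) * (y - 1) ->
  0 <= t * (t - 1) * (x - 1) *
    (kantorovich_formula y t - kantorovich_formula x t).
Proof.
move=> t0 t1 x0 xy xy1; have y0 := lt_le_trans x0 xy.
have nx : x != 1.
  by apply: contraTneq xy1 => ->; rewrite subrr mul0r ltxx.
have ny : y != 1.
  by apply: contraTneq xy1 => ->; rewrite subrr mulr0 ltxx.
have S := @powR_chord_mono R t _ _ x0 xy xy1.
have [x1|x1|x1] := ltgtP x 1; last by rewrite x1 eqxx in nx.
(* The extremal point of the argument nearer to [1] (here [y], below [x]) is tested in the chord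
   inequality of the other one; the slopes are then compared by [S]. *)
- have [z [z0 zy Ez]] := @kantorovich_formula_attained R t y t0 t1 y0 ny.
  have H := @kantorovich_formula_chord R t x z t0 t1 x0 nx z0.
  rewrite -(pmulr_lge0 _ (powR_gt0 t z0)).
  have y1 : y - 1 < 0 by nra.
  have z1 : z <= 1 by nra.
  set kx := kantorovich_formula x t in H *.
  set ky := kantorovich_formula y t in Ez *.
  have -> : t * (t - 1) * (x - 1) * (ky - kx) * z `^ t =
    (1 - x) * (t * (t - 1) * (kx * z `^ t - ky * z `^ t)) by ring.
  by rewrite Ez mulr_ge0 //; nra.
- have [z [z0 zx Ez]] := @kantorovich_formula_attained R t x t0 t1 x0 nx.
  have H := @kantorovich_formula_chord R t y z t0 t1 y0 ny z0.
  rewrite -(pmulr_lge0 _ (powR_gt0 t z0)).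
  have z1 : 1 <= z by nra.
  set kx := kantorovich_formula x t in Ez *.
  set ky := kantorovich_formula y t in H *.
  have -> : t * (t - 1) * (x - 1) * (ky - kx) * z `^ t =
    (x - 1) * (t * (t - 1) * (ky * z `^ t - kx * z `^ t)) by ring.
  by rewrite Ez mulr_ge0 //; nra.
Qed.

Lemma kantorovich_formula_sub1 (R : realType) (t x : R) :
  t != 0 -> t != 1 -> 0 < x -> x != 1 ->
  0 <= t * (t - 1) * (kantorovich_formula x t - 1).
Proof.
move=> t0 t1 x0 x1.
have := @kantorovich_formula_chord R t x 1 t0 t1 x0 x1 ltr01.
by rewrite powR1 subrr mulr0 mulr1 addr0.
Qed.

(** Carathéodory's form of the derivative gives [y ^ t - 1 = g y * (y - 1)] with [g] continuous at
    [1] and [g 1 = t]. All factors [y - 1] cancel from the formula, and what remains tends to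
    [1 * 1 ^ t]. *)
Lemma kantorovich_1 (R : realType) (t : R) : t != 0 -> t != 1 ->
  kantorovich 1 t = 1.
Proof.
move=> t0 t1; rewrite /kantorovich eqxx.
have /is_derive1_caratheodory[g [gE gC g1]] := @is_derive1_powR R t 1 ltr01.
rewrite powR1 mulr1 in g1.
have gcvg : g y @[y --> (1 : R)^'] --> t.
  by rewrite -g1; apply/continuous_withinNx.
have nt : t - 1 != 0 by rewrite subr_eq0.
have acvg : (g y - 1) / (t - 1) @[y --> (1 : R)^'] --> (1 : R).
  rewrite -[X in _ --> X](divff nt); apply: cvgMr_tmp.
  by apply: cvgB => //; exact: cvg_cst.
have bcvg : (t - 1) / t * (g y / (g y - 1)) @[y --> (1 : R)^'] --> (1 : R).
  rewrite [X in _ --> X](_ : 1 = (t - 1) / t * (t / (t - 1))); last first.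
    by field; rewrite t0 nt.
  apply: cvgMl_tmp; apply: cvgM => //; apply: cvgV => //.
  by apply: cvgB => //; exact: cvg_cst.
apply: cvg_lim; first exact: Rhausdorff.
have : (g y - 1) / (t - 1) * ((t - 1) / t * (g y / (g y - 1))) `^ t
    @[y --> (1 : R)^'] --> (1 : R).
  rewrite -[X in _ --> X]mulr1; apply: cvgM => //.
  rewrite [X in _ --> X](_ : 1 = 1 `^ t); last by rewrite powR1.
  have C1 : {for (1 : R), continuous (fun z : R => z `^ t)}.
    apply: differentiable_continuous; apply/derivable1_diffP.
    by have [] := @is_derive1_powR R t 1 ltr01.
  exact: (continuous_cvg _ C1 bcvg).
apply: cvg_trans; apply: near_eq_cvg.
near=> y.
have y1 : y - 1 != 0 by rewrite subr_eq0; near: y; exact: nbhs_dnbhs_neq.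
have := gE y; rewrite powR1 => /eqP; rewrite subr_eq => /eqP yE.
rewrite /kantorovich_formula.
have -> : y `^ t - y = (g y - 1) * (y - 1) by rewrite yE; ring.
have -> : y `^ t - 1 = g y * (y - 1) by rewrite yE; ring.
by rewrite -!mulf_div divff// !mulr1.
Unshelve. all: end_near.
Qed.

Theorem proposition3p1 (R : realType) (t : R) :
  (t < 0 \/ 1 < t ->
    [/\ {in `]0, 1[ &, nonincreasing_fun (fun x : R => kantorovich x t)},
        {in `]1, +oo[ &, nondecreasing_fun (fun x : R => kantorovich x t)},
        kantorovich 1 t = 1
      & forall x : R, 0 < x -> 1 <= kantorovich x t]) /\
  (0 < t < 1 ->
    [/\ {in `]0, 1[ &, nondecreasing_fun (fun x : R => kantorovich x t)},
        {in `]1, +oo[ &, nonincreasing_fun (fun x : R => kantorovich x t)},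
        kantorovich 1 t = 1
      & forall x : R, 0 < x -> kantorovich x t <= 1]).
Proof.
have kE (x : R) : x != 1 -> kantorovich x t = kantorovich_formula x t.
  by rewrite /kantorovich => /negPf ->.
have lt1 (x y : R) : t != 0 -> t != 1 -> 0 < x < 1 -> 0 < y < 1 -> x <= y ->
    0 <= t * (t - 1) * (kantorovich x t - kantorovich y t).
  move=> t0 t1 /andP[x0 x1] /andP[y0 y1] xy; rewrite !kE ?lt_eqF//.
  (* The positive factor [1 - x] restores the weight [x - 1] of the general monotonicity statement,
     up to a sign absorbed by the swapped difference. *)
  rewrite -(@pmulr_rge0 _ (1 - x)) ?subr_gt0//.
  have xy1 : 0 < (x - 1) * (y - 1) by nra.
  have := @kantorovich_formula_mono R t x y t0 t1 x0 xy xy1.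
  by congr (0 <= _); ring.
have gt1 (x y : R) : t != 0 -> t != 1 -> 1 < x -> 1 < y -> x <= y ->
    0 <= t * (t - 1) * (kantorovich y t - kantorovich x t).
  move=> t0 t1 x1 y1 xy; rewrite !kE ?gt_eqF//.
  rewrite -(@pmulr_rge0 _ (x - 1)) ?subr_gt0//.
  have xy1 : 0 < (x - 1) * (y - 1) by nra.
  have x0 := lt_trans ltr01 x1.
  have := @kantorovich_formula_mono R t x y t0 t1 x0 xy xy1.
  by congr (0 <= _); ring.
have sub1 (x : R) : t != 0 -> t != 1 -> 0 < x ->
    0 <= t * (t - 1) * (kantorovich x t - 1).
  move=> t0 t1 x0; have [->|x1] := eqVneq x 1.
    by rewrite kantorovich_1// subrr mulr0.
  by rewrite kE// kantorovich_formula_sub1.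
(* Only the sign of [t * (t - 1)] separates the two ranges: positive in the first, negative in the
   second, where every inequality is reversed. *)
split=> [ht|/andP[ht0 ht1]].
- have [t0 t1] : t != 0 /\ t != 1 by split; apply/eqP => E; case: ht; lra.
  have k0 : 0 < t * (t - 1) by case: ht => ?; nra.
  split; [| |exact: kantorovich_1|].
  + move=> x y; rewrite !in_itv/= => x01 y01 xy.
    by rewrite -subr_ge0 -(pmulr_rge0 _ k0) lt1.
  + move=> x y; rewrite !in_itv/= !andbT => x1 y1 xy.
    by rewrite -subr_ge0 -(pmulr_rge0 _ k0) gt1.
  + by move=> x x0; rewrite -subr_ge0 -(pmulr_rge0 _ k0) sub1.
- have t0 : t != 0 by rewrite gt_eqF.
  have t1 : t != 1 by rewrite lt_eqF.
  have k0 : t * (t - 1) < 0 by nra.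
  split; [| |exact: kantorovich_1|].
  + move=> x y; rewrite !in_itv/= => x01 y01 xy.
    by rewrite -subr_le0 -(nmulr_rge0 _ k0) lt1.
  + move=> x y; rewrite !in_itv/= !andbT => x1 y1 xy.
    by rewrite -subr_le0 -(nmulr_rge0 _ k0) gt1.
  + by move=> x x0; rewrite -subr_le0 -(nmulr_rge0 _ k0) sub1.
Qed.
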